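(* Let $(A,\rho,\mathbb{B})$ be a complete local contact algebra (CLCA), $X=\Psi^a(A,\rho,\mathbb{B})$ and let $I$ be a $\delta$-ideal of $(A,\rho,\mathbb{B})$. Set $a_I=\bigvee I$ and $B=A|a_I$. For $a,b\in B$, set $a\,\eta\, b$ iff there exist $c,d\in I$ such that $c\,\rho\, d$, $c\le a$ and $d\le b$. Then $(B,\eta,I)$ is a CLCA. If $\varphi:A\to B$ is the natural epimorphism, i.e. $\varphi(a)=a\wedge a_I$ for every $a\in A$, then $\varphi:(A,\rho,\mathbb{B})\to(B,\eta,I)$ is a $\mathbf{DOpLC}$-morphism. Set $U=\Psi^a(B,\eta,I)$ and $f=\Psi^a(\varphi)$. Then $f:U\to X$ is an open injection and $f(U)=\iota(I)$, where $\iota(I)=\bigcup\{\lambda_A^g(a) : a\in I\}$ (an open subset of $X$). Hence $U$ is homeomorphic to $\iota(I)$ and, thus, $(B,\eta,I)$ is isomorphic to the dual object $\Psi^t(\iota(I))$ of the open set $\iota(I)$.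
   Context: A local contact algebra (LCA) is a triple $(A,\rho,\mathbb{B})$, where $A$ is a Boolean algebra, $\rho$ is a binary relation on $A$ and $\mathbb{B}$ is an ideal of $A$ (possibly non-proper) such that, writing $a\ll_\rho b$ when $a\,\rho\, b^*$ fails: (C1) $a\ne 0$ implies $a\,\rho\, a$; (C2) $a\,\rho\, b$ implies $a\ne0$ and $b\neq 0$; (C3) $a\,\rho\, b$ implies $b\,\rho\, a$; (C4) $a\,\rho\,(b\vee c)$ iff $a\,\rho\, b$ or $a\,\rho\, c$; (BC1) if $a\in\mathbb{B}$, $c\in A$ and $a\ll_\rho c$ then $a\ll_\rho b\ll_\rho c$ for some $b\in\mathbb{B}$; (BC2) if $a\,\rho\, b$ then there exists $c\in\mathbb{B}$ with $a\,\rho\,(c\wedge b)$; (BC3) if $a\neq0$ then there exists $b\in\mathbb{B}\setminus\{0\}$ with $b\ll_\rho a$. It is a CLCA if $A$ is complete. Two LCAs are isomorphic if there is a Boolean isomorphism that preserves and reflects the relation and maps the ideal onto the ideal. Define $a\,C_\rho\, b$ iff $a\,\rho\, b$ or $a,b\notin\mathbb{B}$. A cluster in $(A,\rho,\mathbb{B})$ is a non-empty $\sigma\subseteq A$ such that: $a,b\in\sigma$ implies $a\,C_\rho\, b$; $a\vee b\in\sigma$ implies $a\in\sigma$ or $b\in\sigma$; if $a\,C_\rho\, b$ for every $b\in\sigma$ then $a\in\sigma$. A cluster (or an ultrafilter of $A$) is bounded if it meets $\mathbb{B}$. $\Psi^a(A,\rho,\mathbb{B})$ is the set of all bounded clusters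 with the topology having as a base for the closed sets the family $\{\lambda_A^g(a) : a\in A\}$, where $\lambda_A^g(a)=\{\sigma : a\in\sigma\}$ ($\sigma$ ranging over bounded clusters). Each bounded ultrafilter $u$ in $A$ determines the bounded cluster $\sigma_u=\{a\in A : a\,C_\rho\, b\ \text{for all } b\in u\}$, and every bounded cluster is of this form. For a locally compact Hausdorff space $Z$, $\Psi^t(Z)=(RC(Z),\rho_Z,CR(Z))$, where $RC(Z)$ is the Boolean algebra of regular closed subsets of $Z$ (with $F\vee G=F\cup G$, $F\wedge G=\mathrm{cl}(\mathrm{int}(F\cap G))$, $F^*=\mathrm{cl}(Z\setminus F)$), $F\,\rho_Z\, G$ iff $F\cap G\neq\emptyset$, and $CR(Z)$ is the ideal of compact regular closed sets. A $\mathbf{DOpLC}$-morphism $\varphi:(A,\rho,\mathbb{B})\to(B,\eta,\mathbb{B}')$ between CLCAs is a complete Boolean homomorphism $\varphi:A\to B$ (i.e. preserving all joins and meets) which, with $\varphi_\Lambda:B\to A$ denoting its left (lower) adjoint ($\varphi_\Lambda(b)\le a$ iff $b\le\varphi(a)$), satisfies: (L1) for all $a,b\in A$, $\varphi(a)\,\eta\,\varphi(b)$ implies $a\,\rho\, b$; (L2) $b\in\mathbb{B}'$ implies $\varphi_\Lambda(b)\in\mathbb{B}$; (LO) for all $a\in A$, $b\in\mathbb{B}'$, $\varphi_\Lambda(b)\,\rho\, a$ implies $b\,\eta\,\varphi(a)$. For such $\varphi$, the map $\Psi^a(\varphi):\Psi^a(B,\eta,\mathbb{B}')\to\Psi^a(A,\rho,\mathbb{B})$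 is given by $\Psi^a(\varphi)(\sigma_u)=\sigma_{\varphi^{-1}(u)}$ for every bounded ultrafilter $u$ in $(B,\eta,\mathbb{B}')$; it is a well-defined continuous map. A $\delta$-ideal of $(A,\rho,\mathbb{B})$ is an ideal $I$ of $A$ such that $I\subseteq\mathbb{B}$ and for any $a\in I$ there exists $b\in I$ with $a\ll_\rho b$. For $a_0\in A$, $A|a_0$ is the Boolean algebra $\{b\in A : b\le a_0\}$ with the meets and joins of $A$ and complement $b'=b^*\wedge a_0$. *)

(* Defs.v *)
From HB Require Import structures.
From mathcomp Require Import all_boot all_order.
From mathcomp Require Import boolp classical_sets functions topology.

Set Implicit Arguments.
Unset Strict Implicit.
Unset Printing Implicit Defensive.

Import Order.Theory.
Local Open Scope classical_set_scope.
Local Open Scope order_scope.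

Section Algebra.
Context {d : Order.disp_t} {A : ctbDistrLatticeType d}.
Implicit Types (rho : A -> A -> Prop) (bd I S u sigma : set A) (a b c : A).

Definition complete_lattice (L : ctbDistrLatticeType d) : Prop :=
  forall S : set L, supremums S !=set0.

Definition is_ideal I : Prop :=
  [/\ I \bot, forall a b, I b -> a <= b -> I a
    & forall a b, I a -> I b -> I (a `|` b)].

Definition ll rho a b : Prop := ~ rho a (~` b).

Record is_lca rho bd : Prop := IsLca {
  lca_ideal : is_ideal bd;
  lca_C1 : forall a, a <> \bot -> rho a a;
  lca_C2 : forall a b, rho a b -> a <> \bot /\ b <> \bot;
  lca_C3 : forall a b, rho a b -> rho b a;
  lca_C4 : forall a b c, rho a (b `|` c) <-> rho a b \/ rho a c;
  lca_BC1 : forall a c, bd a -> ll rho a c ->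
    exists b, [/\ bd b, ll rho a b & ll rho b c];
  lca_BC2 : forall a b, rho a b -> exists c, bd c /\ rho a (c `&` b);
  lca_BC3 : forall a, a <> \bot ->
    exists b, [/\ bd b, b <> \bot & ll rho b a] }.

Record is_clca rho bd : Prop := IsClca {
  clca_lca :> is_lca rho bd;
  clca_complete : complete_lattice A }.

Definition delta_ideal rho bd I : Prop :=
  [/\ is_ideal I, (I `<=` bd)%classic
    & forall a, I a -> exists b, I b /\ ll rho a b].

Definition Crel rho bd a b : Prop := rho a b \/ (~ bd a /\ ~ bd b).

Record is_cluster rho bd sigma : Prop := IsCluster {
  cluster_neq0 : sigma !=set0;
  cluster_K1 : forall a b, sigma a -> sigma b -> Crel rho bd a b;
  cluster_K2 : forall a b, sigma (a `|` b) -> sigma a \/ sigma b;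
  cluster_K3 : forall a, (forall b, sigma b -> Crel rho bd a b) -> sigma a }.

Definition is_proper_filter u : Prop :=
  [/\ u !=set0, ~ u \bot, forall a b, u a -> a <= b -> u b
    & forall a b, u a -> u b -> u (a `&` b)].

Definition is_ultrafilter u : Prop :=
  is_proper_filter u /\
  forall v, is_proper_filter v -> (u `<=` v)%classic -> v = u.

(* Applies both to clusters and to ultrafilters. *)
Definition meets_bd bd S : Prop := exists2 a, S a & bd a.

Definition cluster_of rho bd u : set A :=
  [set a | forall b, u b -> Crel rho bd a b].

End Algebra.

Section AlgebraTheory.
Context {d : Order.disp_t} {A : ctbDistrLatticeType d}.
Context {rho : A -> A -> Prop} {bd : set A} (H : is_lca rho bd).
Implicit Types (S u v sigma : set A) (a b c : A).

Lemma contact_mono a b a' b' : rho a b -> a <= a' -> b <= b' -> rho a' b'.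
Proof.
have monor x y z : rho x y -> y <= z -> rho x z.
  by move=> xy /join_idPr <-; apply/(lca_C4 H); left.
move=> ab aa' bb'; apply: (monor _ _ _ _ bb'); apply: (lca_C3 H).
by apply: (monor _ _ _ _ aa'); apply: (lca_C3 H).
Qed.

Lemma Crel_sym a b : Crel rho bd a b -> Crel rho bd b a.
Proof. by case=> [/(lca_C3 H)|[]]; [left|right]. Qed.

Lemma Crel_mono a b a' : Crel rho bd a b -> a <= a' -> Crel rho bd a' b.
Proof.
have [_ Hd _] := lca_ideal H.
case=> [ab|[na nb]] aa'; first by left; apply: contact_mono ab aa' _.
by right; split=> // /Hd /(_ aa').
Qed.

Lemma Crel0 a : ~ Crel rho bd a \bot.
Proof.
have [H0 _ _] := lca_ideal H.
by case=> [/(lca_C2 H)[]|[]].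
Qed.

Lemma cluster_up sigma a b :
  is_cluster rho bd sigma -> sigma a -> a <= b -> sigma b.
Proof.
move=> K sa ab; apply: (cluster_K3 K) => c sc.
exact: Crel_mono (cluster_K1 K sa sc) ab.
Qed.

Lemma cluster_not0 sigma : is_cluster rho bd sigma -> ~ sigma \bot.
Proof. by move=> K s0; apply: (@Crel0 \bot); apply: (cluster_K1 K). Qed.

Lemma cluster_eq sigma tau : is_cluster rho bd sigma -> is_cluster rho bd tau ->
  (sigma `<=` tau)%classic -> sigma = tau.
Proof.
move=> Ks Kt st; apply/seteqP; split=> // a ta.
by apply: (cluster_K3 Ks) => b /st tb; apply: (cluster_K1 Kt).
Qed.

End AlgebraTheory.

Section Ultrafilters.
Context {d : Order.disp_t} {A : ctbDistrLatticeType d}.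
Implicit Types (u : set A) (a b : A).

Lemma prime_ultrafilter u :
  is_proper_filter u -> (forall a, u a \/ u (~` a)) -> is_ultrafilter u.
Proof.
move=> Fu pu; split=> // v [_ v0 _ vI] uv; apply/seteqP; split=> // a va.
case: (pu a) => // /uv vna; case: v0.
by rewrite -(meetxC a); apply: vI.
Qed.

Lemma ultrafilter_prime u : is_ultrafilter u -> forall a, u a \/ u (~` a).
Proof.
move=> [[[x ux] u0 uu uI] mx] a; apply/or_asboolP; apply/orP.
case: (asboolP (u a)) => [|na]; first by left.
case: (asboolP (u (~` a))) => [|nna]; first by right.
exfalso; pose v := [set y | exists2 m, u m & m `&` a <= y].
have uv : (u `<=` v)%classic by move=> m um; exists m => //; apply: leIl.
suff /mx/(_ uv) vu : is_proper_filter v.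
  by apply: na; rewrite -vu; exists x => //; apply: leIr.
split.
- by exists x; apply: uv.
- case=> m um; rewrite lex0 => /eqP ma; apply: nna; apply: uu um _.
  by rewrite -disj_leC ma.
- by move=> y z [m um my] yz; exists m => //; apply: le_trans yz.
- move=> y z [m um my] [n un nz]; exists (m `&` n); first exact: uI.
  rewrite lexI; apply/andP; split.
    by apply: le_trans my; rewrite leI2// leIl.
  by apply: le_trans nz; rewrite leI2// leIr.
Qed.

End Ultrafilters.

Section ClusterOf.
Context {d : Order.disp_t} {A : ctbDistrLatticeType d}.
Context {rho : A -> A -> Prop} {bd : set A} (H : is_lca rho bd).
Implicit Types (S u v sigma : set A) (a b c : A).

Lemma Crel_bounded_filter u a : is_proper_filter u -> meets_bd bd u ->
  (forall b, u b -> Crel rho bd a b) -> forall b, u b -> rho a b.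
Proof.
move=> [_ _ _ uI] [b0 ub0 bb0] aC b ub.
have [_ Hd _] := lca_ideal H.
have bI : bd (b `&` b0) by apply: Hd bb0 _; apply: leIr.
case: (aC _ (uI _ _ ub ub0)) => [r|[_ /(_ bI)//]].
by apply: (contact_mono H r) => //; apply: leIl.
Qed.

Lemma ultrafilter_sub_cluster u :
  is_ultrafilter u -> (u `<=` cluster_of rho bd u)%classic.
Proof.
move=> [[_ u0 _ uI] _] a ua b ub; left.
have /(lca_C1 H) r : a `&` b <> \bot by move=> e; apply: u0; rewrite -e; apply: uI.
by apply: (contact_mono H r) => //; [apply: leIl|apply: leIr].
Qed.

Lemma cluster_of_cluster u :
  is_ultrafilter u -> meets_bd bd u -> is_cluster rho bd (cluster_of rho bd u).
Proof.
move=> Uu Bu; have [Fu _] := Uu; have [[x ux] u0 uu uI] := Fu.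
have [_ Hd _] := lca_ideal H.
have rE := Crel_bounded_filter Fu Bu.
split.
- by exists x; apply: ultrafilter_sub_cluster.
- have [b0 ub0 bb0] := Bu => a1 a2 s1 s2.
  have [|b1 [bb1 b01 _]] := lca_BC1 H (c := \top) bb0.
    by rewrite /ll compl1 => /(lca_C2 H)[].
  apply: contrapT => nC.
  have s1' b : u b -> rho (a1 `&` b1) b.
    move=> ub; have /(lca_C3 H) := rE _ s1 _ (uI _ _ ub ub0).
    rewrite -{1}[a1](joinIB b1) => /(lca_C4 H)[/(lca_C3 H) r|/(lca_C3 H) r].
      by apply: (contact_mono H r) => //; apply: leIl.
    exfalso; apply: b01; apply: (lca_C3 H); apply: (contact_mono H r) => //.
      by rewrite diffE leIr.
    exact: leIr.
  have [||e [be a1e ea2]] := lca_BC1 H (a := a1 `&` b1) (c := ~` a2).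
  + by apply: Hd bb1 _; apply: leIr.
  + rewrite /ll complK => r; apply: nC; left.
    by apply: (contact_mono H r) => //; apply: leIl.
  case: (ultrafilter_prime Uu e) => ue; last by apply: a1e; apply: s1'.
  by apply: ea2; rewrite complK; apply: (lca_C3 H); apply: rE.
- move=> a b sab; case: (pselect (cluster_of rho bd u a)) => sa; first by left.
  right=> c uc; left.
  have [e ue ae] : exists2 e, u e & ~ rho a e.
    apply: contrapT => ne; apply: sa => e ue; left.
    by apply: contrapT => nr; apply: ne; exists e.
  have /(lca_C3 H)/(lca_C4 H) := rE _ sab _ (uI _ _ uc ue).
  case=> /(lca_C3 H) r; last by apply: (contact_mono H r) => //; apply: leIl.
  by case: ae; apply: (contact_mono H r) => //; apply: leIr.
- by move=> a aC b ub; apply: aC; apply: ultrafilter_sub_cluster.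
Qed.

Lemma cluster_of_bounded u :
  is_ultrafilter u -> meets_bd bd u -> meets_bd bd (cluster_of rho bd u).
Proof. by move=> Uu [b ub bb]; exists b => //; apply: ultrafilter_sub_cluster. Qed.

Lemma cluster_is_cluster_of sigma :
  is_cluster rho bd sigma -> meets_bd bd sigma ->
  exists u, [/\ is_ultrafilter u, meets_bd bd u & cluster_of rho bd u = sigma].
Proof.
move=> K [a0 sa0 ba0].
pose P (F : set A) := [/\ forall a b, F a -> a <= b -> F b,
  forall a b, F a -> F b -> F (a `&` b) & forall a, F a -> sigma (a `&` a0)].
have [G GP tG|M [[Mu MI Ms] mx]] := @Zorn_bigcup A P.
  split.
  - by move=> a b [F GF Fa] ab; exists F => //; have [Fu _ _] := GP _ GF; apply: Fu ab.
  - move=> a b [F1 G1 Fa] [F2 G2 Fb].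
    have [_ I1 _] := GP _ G1; have [_ I2 _] := GP _ G2.
    by have [F12|F21] := tG _ _ G1 G2; [exists F2|exists F1] => //;
      [apply: I2 => //; apply: F12|apply: I1 => //; apply: F21].
  - by move=> a [F GF Fa]; have [_ _] := GP _ GF; apply.
have ext a : (forall m, M m -> sigma (m `&` a `&` a0)) ->
    M !=set0 -> M a.
  move=> h [x Mx]; apply: contrapT => nMa.
  pose N := [set y | exists2 m, M m & m `&` a <= y].
  apply: (mx N).
    split; first by move=> m Mm; exists m => //; apply: leIl.
    by move=> NM; apply: nMa; apply: NM; exists x => //; apply: leIr.
  split.
  - by move=> y z [m Mm my] yz; exists m => //; apply: le_trans yz.
  - move=> y z [m um my] [n un nz]; exists (m `&` n); first exact: MI.
    rewrite lexI; apply/andP; split.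
      by apply: le_trans my; rewrite leI2// leIl.
    by apply: le_trans nz; rewrite leI2// leIr.
  - move=> y [m Mm my]; apply: (cluster_up H K (h _ Mm)).
    by rewrite leI2.
have Mn0 : M !=set0.
  apply: contrapT => M0; apply: (mx [set y | a0 <= y]).
    split; first by move=> m Mm; case: M0; exists m.
    by move=> /(_ a0 (lexx _)) Ma; apply: M0; exists a0.
  split.
  - by move=> a b; apply: le_trans.
  - by move=> a b /= ha hb; rewrite lexI ha.
  - by move=> a /= /meet_idPr ->.
have Mp a : M a \/ M (~` a).
  case: (pselect (M a)) => Ma; first by left.
  right; apply: (ext _ _ Mn0) => m Mm.
  have [n Mn na] : exists2 n, M n & ~ sigma (n `&` a `&` a0).
    apply: contrapT => ne; apply: Ma; apply: (ext _ _ Mn0) => n Mn.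
    by apply: contrapT => ns; apply: ne; exists n.
  have := Ms _ (MI _ _ Mm Mn).
  have -> : m `&` n `&` a0
      = (m `&` n `&` a `&` a0) `|` (m `&` n `&` ~` a `&` a0).
    by rewrite -meetUl -meetUr joinxC meetx1.
  case/(cluster_K2 K) => s; last first.
    by apply: (cluster_up H K s); rewrite !leI2// leIl.
  by case: na; apply: (cluster_up H K s); rewrite !leI2// leIr.
have s0 := cluster_not0 H K.
have M0 : ~ M \bot by move=> /Ms; rewrite meet0x.
have Ma0 : M a0.
  by case: (Mp a0) => // /Ms; rewrite meetC meetxC.
have FM : is_proper_filter M by split.
have UM := prime_ultrafilter FM Mp.
have BM : meets_bd bd M by exists a0.
exists M; split=> //; apply/esym/(cluster_eq K).
  exact: cluster_of_cluster.
move=> a sa b Mb; apply: (cluster_K1 K) => //.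
by apply: (cluster_up H K (Ms _ Mb)); apply: leIl.
Qed.

End ClusterOf.

Section PsiA.
Context {d : Order.disp_t} {A : ctbDistrLatticeType d}.
Context {rho : A -> A -> Prop} {bd : set A}.

(* The underlying set of Psi^a(A, rho, bd).  The type depends on the proof of
   the LCA axioms, which are needed to equip it with its topology. *)
Record Psi_a (H : is_lca rho bd) := BCluster {
  bcluster :> set A;
  bclusterP : is_cluster rho bd bcluster;
  bcluster_bounded : meets_bd bd bcluster }.

Definition bu_cluster (H : is_lca rho bd) (u : set A)
    (Uu : is_ultrafilter u) (Bu : meets_bd bd u) : Psi_a H :=
  BCluster H (cluster_of_cluster H Uu Bu) (cluster_of_bounded H Uu Bu).

Section Topology.
Context {H : is_lca rho bd}.

Lemma Psi_aP (s t : Psi_a H) : bcluster s = bcluster t -> s = t.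
Proof.
case: s t => [s ks bs] [t kt bt] /= e; subst t.
by rewrite (Prop_irrelevance ks kt) (Prop_irrelevance bs bt).
Qed.

HB.instance Definition _ := gen_eqMixin (Psi_a H).
HB.instance Definition _ := gen_choiceMixin (Psi_a H).

Definition lambda (a : A) : set (Psi_a H) := [set s | bcluster s a].

Let D : set (set (Psi_a H)) := [set (~` lambda a)%classic | a in setT].

Let D_cover : \bigcup_(O in D) O = setT.
Proof.
apply/seteqP; split=> // s _; exists (~` lambda \bot)%classic.
  by exists \bot.
by move=> /(cluster_not0 H (bclusterP s)).
Qed.

Let D_join O1 O2 s : D O1 -> D O2 -> O1 s -> O2 s ->
  exists O, [/\ D O, O s & (O `<=` O1 `&` O2)%classic].
Proof.
move=> [a _ <-] [b _ <-] sa sb; exists (~` lambda (a `|` b)%O)%classic; split.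
- by exists (a `|` b).
- by case/(cluster_K2 (bclusterP s)).
- move=> t nt; split=> ta; apply: nt.
    by apply: (cluster_up H (bclusterP t) ta); apply: leUl.
  by apply: (cluster_up H (bclusterP t) ta); apply: leUr.
Qed.

HB.instance Definition _ :=
  isBaseTopological.Build (Psi_a H) D_cover D_join.

Lemma Psi_a_closedP (F : set (Psi_a H)) :
  closed F <-> exists S : set A, F = \bigcap_(a in S) lambda a.
Proof.
split=> [cF|[S ->]].
- have [E ED FE] : exists2 E : set (set (Psi_a H)), (E `<=` D)%classic &
      \bigcup_(O in E) O = (~` F)%classic.
    by have := closed_openC cF.
  exists [set a | E (~` lambda a)%classic]; rewrite -[F]setCK -FE setC_bigcup.
  apply/seteqP; split=> s h.
    by move=> a Ea; have := h _ Ea; rewrite setCK.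
  by move=> O EO; have [a _ e] := ED _ EO; rewrite -e setCK; apply: h; rewrite /= e.
- apply: closed_bigI => a _; rewrite -[lambda a]setCK; apply: open_closedC.
  exists [set (~` lambda a)%classic]; last by rewrite bigcup_set1.
  by move=> _ ->; exists a.
Qed.

End Topology.

Definition iota_lca (H : is_lca rho bd) (I : set A) : set (Psi_a H) :=
  \bigcup_(a in I) lambda a.

End PsiA.

Arguments iota_lca {d A rho bd} H I _.

Section Morphisms.
Context {d : Order.disp_t} {A : ctbDistrLatticeType d}.
Context {d' : Order.disp_t} {B : ctbDistrLatticeType d'}.
Implicit Type phi : A -> B.

Definition bool_hom phi : Prop :=
  [/\ phi \bot = \bot, phi \top = \top, {morph phi : a b / a `&` b},
      {morph phi : a b / a `|` b} & {morph phi : a / ~` a}].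

Definition complete_bool_hom phi : Prop :=
  [/\ bool_hom phi,
      forall (S : set A) s, supremums S s -> supremums (phi @` S)%classic (phi s)
    & forall (S : set A) s, infimums S s -> infimums (phi @` S)%classic (phi s)].

Definition lower_adjoint phi (phiL : B -> A) : Prop :=
  forall a b, (phiL b <= a) = (b <= phi a).

Record is_doplc (rho : A -> A -> Prop) (bd : set A)
    (eta : B -> B -> Prop) (bd' : set B) phi (phiL : B -> A) : Prop := IsDoplc {
  doplc_hom : complete_bool_hom phi;
  doplc_adj : lower_adjoint phi phiL;
  doplc_L1 : forall a b, eta (phi a) (phi b) -> rho a b;
  doplc_L2 : forall b, bd' b -> bd (phiL b);
  doplc_LO : forall a b, bd' b -> rho (phiL b) a -> eta b (phi a) }.

(* The lower adjoint is unique when it exists. *)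
Definition doplc_morphism (rho : A -> A -> Prop) (bd : set A)
    (eta : B -> B -> Prop) (bd' : set B) phi : Prop :=
  exists phiL, is_doplc rho bd eta bd' phi phiL.

Definition lca_isomorphic (rho : A -> A -> Prop) (bd : set A)
    (eta : B -> B -> Prop) (bd' : set B) : Prop :=
  exists h : A -> B, [/\ bijective h, bool_hom h,
    forall a b, rho a b <-> eta (h a) (h b) & (h @` bd)%classic = bd'].

End Morphisms.

Section PsiAMap.
Context {d : Order.disp_t} {A : ctbDistrLatticeType d}.
Context {d' : Order.disp_t} {B : ctbDistrLatticeType d'}.
Context {rho : A -> A -> Prop} {bd : set A}.
Context {eta : B -> B -> Prop} {bd' : set B} {phi : A -> B}.
Context (HA : is_lca rho bd) (HB : is_lca eta bd').
Context (Hphi : doplc_morphism rho bd eta bd' phi).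

Lemma preim_ultrafilter u : is_ultrafilter u -> is_ultrafilter (phi @^-1` u)%classic.
Proof.
have [phiL [[[h0 h1 hI _ hC] _ _] _ _ _ _]] := Hphi.
move=> Uu; have [[[x ux] u0 uu uI] _] := Uu.
apply: prime_ultrafilter; last first.
  by move=> a; rewrite /= /preimage /= hC; apply: ultrafilter_prime.
split; rewrite /preimage /=.
- by exists \top => /=; rewrite h1; apply: uu ux _; apply: lex1.
- by rewrite h0.
- move=> a b ua /meet_idPl ab; apply: uu ua _.
  by rewrite -ab hI leIr.
- by move=> a b ua ub; rewrite hI; apply: uI.
Qed.

Lemma preim_bounded u : is_ultrafilter u -> meets_bd bd' u ->
  meets_bd bd (phi @^-1` u)%classic.
Proof.
have [phiL [_ adj _ L2 _]] := Hphi.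
move=> [[_ _ uu _] _] [b ub bb]; exists (phiL b); last exact: L2.
by apply: uu ub _; rewrite -adj.
Qed.

Lemma Psi_a_surj (s : Psi_a HB) :
  exists u, [/\ is_ultrafilter u, meets_bd bd' u & cluster_of eta bd' u = s].
Proof. by apply: cluster_is_cluster_of; case: s. Qed.

(* Psi^a(phi): choose a bounded ultrafilter u with sigma_u = s; the result does
   not depend on this choice, see Psi_a_mapE. *)
Definition Psi_a_map (s : Psi_a HB) : Psi_a HA :=
  let: exist u (And3 Uu Bu _) := cid (Psi_a_surj s) in
  bu_cluster HA (preim_ultrafilter Uu) (preim_bounded Uu Bu).

Lemma preim_cluster_sub u v : is_ultrafilter u -> meets_bd bd' u ->
  is_ultrafilter v -> meets_bd bd' v ->
  cluster_of eta bd' u = cluster_of eta bd' v ->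
  (cluster_of rho bd (phi @^-1` u) `<=` cluster_of rho bd (phi @^-1` v))%classic.
Proof.
have [phiL [_ _ L1 _ _]] := Hphi.
move=> Uu Bu Uv Bv uv a sa b vb; have [Fv _] := Uv.
have K := cluster_of_cluster HA (preim_ultrafilter Uu) (preim_bounded Uu Bu).
apply: (cluster_K1 K) => //= c uc.
left; apply: (lca_C3 HA); apply: L1.
apply: (Crel_bounded_filter HB Fv Bv) => //.
change (cluster_of eta bd' v (phi c)); rewrite -uv.
exact: (ultrafilter_sub_cluster HB Uu).
Qed.

Lemma Psi_a_mapE (u : set B) (Uu : is_ultrafilter u) (Bu : meets_bd bd' u) :
  Psi_a_map (bu_cluster HB Uu Bu)
  = bu_cluster HA (preim_ultrafilter Uu) (preim_bounded Uu Bu).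
Proof.
rewrite /Psi_a_map; case: cid => v [Uv Bv /= vu].
by apply: Psi_aP; apply/seteqP; split; apply: preim_cluster_sub.
Qed.

End PsiAMap.

Arguments Psi_a_map {d A d' B rho bd eta bd' phi} HA HB Hphi s.

Section Below.
Context {d : Order.disp_t} {A : ctbDistrLatticeType d} (a0 : A).

Definition below : Type := {b : A | b <= a0}.

HB.instance Definition _ := SubChoice.copy below {b : A | b <= a0}.

Let below_meet : meet_closed (fun b : A => b <= a0).
Proof. by move=> x y xa _; apply: le_trans xa; apply: leIl. Qed.

Let below_join : join_closed (fun b : A => b <= a0).
Proof. by move=> x y; rewrite !unfold_in leUx => -> ->. Qed.

HB.instance Definition _ :=
  Order.SubChoice_isSubLattice.Build d A (fun b => b <= a0) d below
    below_meet below_join.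

Lemma below_valI (x y : below) : val (x `&` y) = val x `&` val y.
Proof. exact: Order.valI_subproof. Qed.

Lemma below_valU (x y : below) : val (x `|` y) = val x `|` val y.
Proof. exact: Order.valU_subproof. Qed.

Let below_distr : @left_distributive below below Order.meet Order.join.
Proof. by move=> x y z; apply: val_inj; rewrite !(below_valI, below_valU) meetUl. Qed.

HB.instance Definition _ :=
  Order.Lattice_Meet_isDistrLattice.Build d below below_distr.

Definition below0 : below := exist _ \bot (le0x a0).
Definition below1 : below := exist _ a0 (lexx a0).
Definition below_compl (b : below) : below :=
  exist _ (~` val b `&` a0) (leIr _ _).

Let below_le0x (x : below) : below0 <= x.
Proof. exact: le0x. Qed.
Let below_lex1 (x : below) : x <= below1.
Proof. rewrite -Order.le_val; exact: (valP x). Qed.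

HB.instance Definition _ := Order.hasBottom.Build d below below_le0x.
HB.instance Definition _ := Order.hasTop.Build d below below_lex1.

Let below_joinC (x : below) : x `|` below_compl x = \top.
Proof.
apply: val_inj; rewrite below_valU /= joinIr joinxC meet1x.
by apply/join_idPr; exact: (valP x).
Qed.
Let below_meetC (x : below) : x `&` below_compl x = \bot.
Proof. by apply: val_inj; rewrite below_valI /= meetA meetxC meet0x. Qed.

HB.instance Definition _ :=
  Order.TBDistrLattice_hasComplement.Build d below below_joinC below_meetC.

Lemma below_val0 : val (\bot : below) = \bot.
Proof. by []. Qed.

Lemma below_val1 : val (\top : below) = a0.
Proof. by []. Qed.

Lemma below_valC (x : below) : val (~` x) = ~` val x `&` a0.
Proof. by []. Qed.

Definition restr (a : A) : below := exist _ (a `&` a0) (leIr _ _).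

Definition restr_contact (rho : A -> A -> Prop) (I : set A) (a b : below) : Prop :=
  exists c e, [/\ I c, I e, rho c e, c <= val a & e <= val b].

Definition restr_ideal (I : set A) : set below := [set b | I (val b)].

End Below.

Section RegularClosed.
Context (Z : topologicalType).

Record RC := MkRC { rcset :> set Z; rcsetP : regclosed rcset }.

Lemma RC_inj (F G : RC) : rcset F = rcset G -> F = G.
Proof.
case: F G => [F hF] [G hG] /= e; subst G.
by rewrite (Prop_irrelevance hF hG).
Qed.

HB.instance Definition _ := gen_eqMixin RC.
HB.instance Definition _ := gen_choiceMixin RC.

Definition rc_le (F G : RC) : bool := `[< (F `<=` G)%classic >].

Let rc_refl : reflexive rc_le.
Proof. by move=> F; apply/asboolP. Qed.
Let rc_anti : antisymmetric rc_le.
Proof.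
by move=> F G /andP[/asboolP FG /asboolP GF]; apply: RC_inj; apply/seteqP.
Qed.
Let rc_trans : transitive rc_le.
Proof.
by move=> F G K /asboolP FG /asboolP GK; apply/asboolP; apply: subset_trans GK.
Qed.

Fact rc_display : Order.disp_t. Proof. exact: Order.Disp tt tt. Qed.

HB.instance Definition _ :=
  Order.Le_isPOrder.Build rc_display RC rc_refl rc_anti rc_trans.

Lemma rc_leP (F G : RC) : reflect (F `<=` G)%classic (F <= G).
Proof. exact: asboolP. Qed.

Lemma RC_closed (F : RC) : closed F.
Proof. by rewrite -(rcsetP F); apply: closed_closure. Qed.

Lemma regclosed0 : regclosed (set0 : set Z).
Proof. by rewrite /regclosed interior0 closure0. Qed.
Lemma regclosedT : regclosed (setT : set Z).
Proof. by rewrite /regclosed interiorT closureT. Qed.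

Lemma regclosedU (F G : RC) : regclosed (F `|` G)%classic.
Proof.
apply/seteqP; split.
  rewrite [X in (_ `<=` X)%classic](closure_id _).1; last first.    by apply: closedU; apply: RC_closed.
  by apply: closure_subset; apply: interior_subset.
rewrite -{1}(rcsetP F) -{1}(rcsetP G) => x.
by case=> h; apply: closure_subset h; apply: interiorS => y; [left|right].
Qed.

Lemma regclosedI (F G : RC) : regclosed (closure (interior (F `&` G)%classic)).
Proof. by apply: closure_open_regclosed; apply: open_interior. Qed.

Lemma regclosedC (F : RC) : regclosed (closure (~` F)%classic).
Proof. by apply: closure_open_regclosed; apply: closed_openC; apply: RC_closed. Qed.

Definition rc_join (F G : RC) : RC := MkRC (regclosedU F G).
Definition rc_meet (F G : RC) : RC := MkRC (regclosedI F G).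
Definition rc_compl (F : RC) : RC := MkRC (regclosedC F).
Definition rc0 : RC := MkRC regclosed0.
Definition rc1 : RC := MkRC regclosedT.

Let rc_lexI (F G K : RC) : (F <= rc_meet G K) = (F <= G) && (F <= K).
Proof.
apply/rc_leP/andP => [h|[/rc_leP FG /rc_leP FK]].
  have cl : (closure (interior (G `&` K)) `<=` G `&` K)%classic.
    rewrite [X in (_ `<=` X)%classic](closure_id _).1; last first.
      by apply: closedI; apply: RC_closed.
    by apply: closure_subset; apply: interior_subset.
  by split; apply/rc_leP => x /h /cl [].
rewrite -(rcsetP F) /=; apply: closure_subset; apply: interiorS => x Fx.
by split; [apply: FG|apply: FK].
Qed.

Let rc_leUx (F G K : RC) : (rc_join F G <= K) = (F <= K) && (G <= K).
Proof.
apply/rc_leP/andP => [h|[/rc_leP FK /rc_leP GK] x [/FK|/GK]//].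
by split; apply/rc_leP => x ?; apply: h; [left|right].
Qed.

HB.instance Definition _ := Order.POrder_MeetJoin_isLattice.Build rc_display RC
  rc_lexI rc_leUx.

Let rc_distr : @left_distributive RC RC Order.meet Order.join.
Proof.
move=> F G K; apply: le_anti; apply/andP; split; last first.
  rewrite lexI !leUx !leIr !andbT; apply/andP; split; apply: le_trans (leIl _ _) _.
    exact: leUl.
  exact: leUr.
apply/rc_leP => /=; set N := (X in (_ `<=` X)%classic).
have cN : closed N by apply: closedU; apply: closed_closure.
rewrite [N](closure_id N).1//; apply: closure_subset => x Ox.
apply: contrapT => nNx.
pose V := (interior ((F `|` G) `&` K) `&` ~` N)%classic.
have oV : open V by apply: openI; [apply: open_interior|apply: closed_openC].
have VP y : V y -> (rcset F y \/ rcset G y) /\ rcset K y by move=> [/interior_subset].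
have key (E : RC) : (closure (interior (E `&` K)) `<=` N)%classic -> ~ rcset E x.
  move=> EN; rewrite -[rcset E](rcsetP E) => /(_ V) [].
    by apply: open_nbhs_nbhs; split.
  move=> y [Ey Vy]; have [_ nNy] := Vy; apply: nNy; apply: EN.
  apply: subset_closure; rewrite interiorI; split=> //.
  rewrite /interior nbhsE; exists V; first by split.
  by move=> z /VP[].
have [|h _] := VP x; first by split.
by case: h; apply: key => y ?; [left|right].
Qed.

HB.instance Definition _ :=
  Order.Lattice_Meet_isDistrLattice.Build rc_display RC rc_distr.

Let rc_le0x (F : RC) : rc0 <= F.
Proof. by apply/rc_leP => x []. Qed.
Let rc_lex1 (F : RC) : F <= rc1.
Proof. by apply/rc_leP. Qed.

HB.instance Definition _ := Order.hasBottom.Build rc_display RC rc_le0x.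
HB.instance Definition _ := Order.hasTop.Build rc_display RC rc_lex1.

Let rc_joinxC (F : RC) : F `|` rc_compl F = \top.
Proof.
apply: RC_inj; apply/seteqP; split=> //= x _.
case: (pselect (rcset F x)) => h; [by left|right].
exact: subset_closure.
Qed.
Let rc_meetxC (F : RC) : F `&` rc_compl F = \bot.
Proof.
apply: RC_inj => /=; rewrite -[RHS]closure0; congr closure.
apply/seteqP; split=> // x; rewrite closure_setC interiorI.
by move=> [Fx /interior_subset].
Qed.

HB.instance Definition _ := Order.TBDistrLattice_hasComplement.Build rc_display RC
  rc_joinxC rc_meetxC.

Lemma RC_joinE (F G : RC) : rcset (F `|` G)%O = (F `|` G)%classic.
Proof. by []. Qed.

Lemma RC_meetE (F G : RC) :
  rcset (F `&` G)%O = closure (interior (F `&` G)%classic).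
Proof. by []. Qed.

Lemma RC_complE (F : RC) : rcset (~` F)%O = closure (~` F)%classic.
Proof. by []. Qed.

Lemma RC_botE : rcset \bot%O = set0.
Proof. by []. Qed.

Lemma RC_topE : rcset \top%O = setT.
Proof. by []. Qed.

Definition rc_contact (F G : RC) : Prop := (F `&` G !=set0)%classic.

Definition CR : set RC := [set F | compact F].

End RegularClosed.

Definition homeomorphic (S T : topologicalType) : Prop :=
  exists (f : S -> T) (g : T -> S),
    [/\ cancel f g, cancel g f, continuous f & continuous g].

(* Main.v *)
Require Import Defs.
From mathcomp Require Import all_boot all_order.
From mathcomp Require Import boolp classical_sets functions topology.

(** Restricting the algebra to the elements below the join of [I] is harmless
    because contact with an element [a] of [I] is local: if [a] is well inside
    [e], with [e] in [I], then [a] touches [b] only through [b `&` e], which is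
    again in [I].  So for [a] in [I] the new contact is just the old one
    ([restr_contactE]), and both the axioms of a local contact algebra
    ([restr_lca]) and the conditions on the natural epimorphism ([restr_doplc])
    are inherited from [A].

    On bounded clusters the dual map of a morphism [phi] is the inverse image
    under [phi] ([Psi_a_map_preim]).  Continuity is immediate from this.  For
    the restriction, the inclusion [val] is a section of [phi], whence the dual
    map is injective and every closed set of its domain is the inverse image of
    a closed set; it is therefore open as soon as its range is
    ([Psi_a_map_open]).  The range consists of the clusters that meet [I]
    ([range_restr_map]): a cluster meeting [I] comes from an ultrafilter
    that contains the join of [I], and such an ultrafilter is determined by its
    trace below that join.  This set is open because a cluster meets [I] exactly
    when it omits the complement of a member of [I] ([open_iota]).

    What remains holds for every complete local contact algebra: its dual space
    is Hausdorff and locally compact, and the algebra is isomorphic to the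
    algebra of regular closed sets of that space ([lca_representation]).  The
    points that are needed come from ultrafilters inside grills
    ([grill_ultrafilter]).  Since all these notions are invariant under
    homeomorphism, they pass to the open set. *)

Set Implicit Arguments.
Unset Strict Implicit.
Unset Printing Implicit Defensive.

Local Open Scope classical_set_scope.

(** * Contact relations and joins in complete lattices *)

Section Contact.
Import Order.Theory.
Local Open Scope order_scope.
Context {d : Order.disp_t} {A : ctbDistrLatticeType d}.
Context {rho : A -> A -> Prop} {bd : set A} (H : is_lca rho bd).
Implicit Types a b c : A.

Lemma contact_split e a b : rho a b -> rho a (b `&` e) \/ rho a (~` e).
Proof.
rewrite -[b in rho a b](joinIB e) => /(lca_C4 H)[] r; [by left|right].
by apply: (contact_mono H r) => //; rewrite diffE leIr.
Qed.

Lemma ll_le a b : ll rho a b -> a <= b.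
Proof.
move=> nab; rewrite -[b]complK -disj_leC; apply/eqP.
apply: contrapT => n0; apply: nab.
by apply: (contact_mono H (lca_C1 H n0)); [apply: leIl|apply: leIr].
Qed.

(** (BC1) with [c = \top]: this is the source of every compact neighbourhood
    in the dual space. *)
Lemma bounded_ll_bounded a : bd a -> exists e, bd e /\ ll rho a e.
Proof.
move=> ba; have [|e [be ae _]] := lca_BC1 H ba (c := \top); last by exists e.
by rewrite /ll compl1 => /(lca_C2 H)[].
Qed.

End Contact.

Section CompleteLattice.
Import Order.Theory.
Local Open Scope order_scope.
Context {d : Order.disp_t} {A : ctbDistrLatticeType d}.
Implicit Types (S : set A) (a b s : A).

Lemma supremumP S : complete_lattice A -> supremums S (supremum \bot S).
Proof.
move=> cA; rewrite /supremum; case: ifPn => [/eqP->|_].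
  by split=> [x []|x _]; rewrite /= le0x.
exact: xgetPex (cA S).
Qed.

(** [~` a] is an upper bound of any set of elements disjoint from [a]; infinite
    distributivity, in the form [supremums_meet], follows. *)
Lemma supremums_disj S s a : supremums S s ->
  (forall x, S x -> x `&` a = \bot) -> s `&` a = \bot.
Proof.
move=> [_ sl] Sa; apply/eqP; rewrite disj_leC; apply: sl => x Sx.
by rewrite -disj_leC Sa.
Qed.

Lemma supremums_meet S s a b : supremums S s ->
  (forall x, S x -> x `&` a <= b) -> s `&` a <= b.
Proof.
move=> Ss Sb; rewrite -[b]complK -disj_leC -meetA.
apply/eqP; apply: (supremums_disj Ss) => x Sx.
by apply/eqP; rewrite meetA disj_leC complK Sb.
Qed.

End CompleteLattice.

(** * Restriction to a delta-ideal *)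

Section Restriction.
Import Order.Theory.
Local Open Scope order_scope.
Context {d : Order.disp_t} {A : ctbDistrLatticeType d}.
Context {rho : A -> A -> Prop} {bd : set A} (HA : is_clca rho bd).
Context {I : set A} (HI : delta_ideal rho bd I).
Let aI : A := supremum \bot I.
Let B := below aI.
Let eta : B -> B -> Prop := restr_contact rho I.
Let J : set B := restr_ideal I.

Lemma mem_le_supremum a : I a -> a <= aI.
Proof. by move=> Ia; have [+ _] := supremumP I (clca_complete HA); apply. Qed.

(** The ideal is dense below its join, so that the axioms asking for small
    nonzero elements can be tested inside [I]. *)
Lemma meet_ideal_neq0 a : a <= aI -> a <> \bot ->
  exists2 i, I i & i `&` a <> \bot.
Proof.
move=> aaI a0; apply: contrapT => n; apply: a0.
rewrite -(meet_idPr aaI).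
apply: (supremums_disj (supremumP I (clca_complete HA))).
by move=> i Ii; apply: contrapT => ?; apply: n; exists i.
Qed.

Lemma le_below (x y : B) : (x <= y) = (val x <= val y).
Proof. by rewrite Order.le_val. Qed.

Lemma restr_contact_sub (a b : B) : eta a b -> rho (val a) (val b).
Proof. by move=> [c [e [_ _ r ca eb]]]; apply: (contact_mono HA r). Qed.

(** Take [e] in the ideal with [a] well inside [e]: nothing outside [e] can
    touch [a], so any contact of [a] with [b] already happens in the member
    [b `&` e] of [I].  Through this equivalence the axioms and the morphism
    conditions for [eta] are read off from those for [rho]. *)
Lemma restr_contactE (a b : B) : J a -> eta a b <-> rho (val a) (val b).
Proof.
move=> Ja; split; first exact: restr_contact_sub.
have [[_ Id _] _ /(_ _ Ja)[e [Ie nae]]] := HI => /(contact_split HA e)[|//] r.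
exists (val a), (val b `&` e); split=> //; last exact: leIl.
by apply: Id Ie _; apply: leIr.
Qed.

Lemma restr_ll (a b : B) : ll rho (val a) (val b) -> ll eta a b.
Proof.
move=> ab /restr_contact_sub r; apply: ab.
by apply: (contact_mono HA r) => //; rewrite below_valC leIl.
Qed.

(** The same localisation for the strong order: the part of the complement
    of [b] that lies outside the join of [I] also lies outside [e]. *)
Lemma ll_restr (a b : B) : J a -> ll eta a b -> ll rho (val a) (val b).
Proof.
have [[_ Id _] _ Ill] := HI => Ja nab; have [e [Ie nae]] := Ill _ Ja.
move=> /(contact_split HA e)[|//] r; apply: nab; apply/restr_contactE => //.
apply: (contact_mono HA r) => //.
by rewrite below_valC leI2// mem_le_supremum.
Qed.

Lemma restr_lca : is_lca eta J.
Proof.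
have [[I0 Id IU] Ibd Ill] := HI.
have valN0 (x : B) : x <> \bot -> val x <> \bot.
  by move=> x0 e; apply: x0; apply: val_inj.
split.
- split; first exact: I0.
  + by move=> a b Ja; rewrite le_below; apply: Id.
  + by move=> a b Ja Jb; apply: (IU _ _ Ja Jb).
- move=> a /valN0/(meet_ideal_neq0 (valP a))[i Ii n0].
  exists (i `&` val a), (i `&` val a).
  have Iia : I (i `&` val a) by apply: Id Ii _; apply: leIl.
  by split=> //; [apply: (lca_C1 HA)|apply: leIr|apply: leIr].
- move=> a b /restr_contact_sub /(lca_C2 HA)[a0 b0].
  by split=> e; [apply: a0|apply: b0]; rewrite e.
- by move=> a b [c [e [Ic Ie /(lca_C3 HA) r ca eb]]]; exists e, c.
- move=> a b c; split.
    move=> [x [y [Ix Iy r xa]]]; rewrite below_valU => ybc.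
    move: r; rewrite -(meet_idPl ybc) meetUr.
    have Iyz z : I (y `&` z) by apply: Id Iy _; apply: leIl.
    case/(lca_C4 HA) => r; [left|right].
      by exists x, (y `&` val b); split=> //; apply: leIr.
    by exists x, (y `&` val c); split=> //; apply: leIr.
  by case=> -[x [y [Ix Iy r xa yb]]]; exists x, y; split=> //;
    apply: (le_trans yb); rewrite below_valU ?leUl ?leUr.
(* Interpolating below [val c `&` e], with [e] in [I], puts the interpolant
   into [I]. *)
- move=> a c Ja /(ll_restr Ja) nac; have [e [Ie nae]] := Ill _ Ja.
  have [|b [_ ab be]] := lca_BC1 HA (Ibd _ Ja) (c := val c `&` e).
    by rewrite /ll complI => /(lca_C4 HA)[].
  have Ib : I b by apply: Id Ie _; apply: le_trans (ll_le HA be) (leIr _ _).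
  exists (exist _ b (mem_le_supremum Ib)); split=> //; apply: restr_ll => //= r.
  by apply: be; apply: (contact_mono HA r) => //; rewrite leC leIl.
- move=> a b [x [y [Ix Iy r xa yb]]].
  exists (exist _ y (mem_le_supremum Iy)); split=> //; exists x, y; split=> //.
  by rewrite below_valI lexI lexx.
- move=> a /valN0/(meet_ideal_neq0 (valP a))[i Ii n0].
  have [b [_ b0 nb]] := lca_BC3 HA n0.
  have Ib : I b by apply: Id Ii _; apply: le_trans (ll_le HA nb) (leIl _ _).
  exists (exist _ b (mem_le_supremum Ib)); split=> //.
    by move=> /(congr1 val).
  apply: restr_ll => /= r.
  by apply: nb; apply: (contact_mono HA r) => //; rewrite leC leIr.
Qed.

Lemma restr_clca : is_clca eta J.
Proof.
split; first exact: restr_lca.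
move=> S; have [s [su sl]] := clca_complete HA (val @` S)%classic.
have sa : s <= aI by apply: sl => _ [x _ <-]; apply: (valP x).
exists (exist _ s sa); split.
  by move=> x Sx; rewrite le_below /=; apply: su; exists x.
move=> y yu; rewrite le_below /=; apply: sl => _ [x Sx <-].
by rewrite -le_below; apply: yu.
Qed.

Lemma val_restr a : val (restr aI a) = a `&` aI.
Proof. by []. Qed.

Lemma restrK : cancel val (restr aI).
Proof.
by move=> b; apply: val_inj; rewrite val_restr; apply/meet_idPl/(valP b).
Qed.

(** Joins are preserved by infinite distributivity, meets because the meet with
    a fixed element commutes with meets; the empty meet is sent to the new top
    element. *)
Lemma restr_complete_hom : complete_bool_hom (restr aI : A -> B).
Proof.
split.
- split.
  + by apply: val_inj; rewrite val_restr meet0x.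
  + by apply: val_inj; rewrite val_restr meet1x.
  + by move=> a b; apply: val_inj; rewrite below_valI !val_restr meetACA meetxx.
  + by move=> a b; apply: val_inj; rewrite below_valU !val_restr meetUl.
  + move=> a; apply: val_inj; rewrite below_valC !val_restr complI meetUl.
    by rewrite [_ aI `&` aI]meetC meetxC joinx0.
- move=> S s Ss; split.
    move=> _ [x Sx <-]; rewrite le_below !val_restr leI2//.
    by have [+ _] := Ss; apply.
  move=> y yu; rewrite le_below val_restr; apply: (supremums_meet Ss) => x Sx.
  by rewrite -val_restr -le_below; apply: yu; exists x.
- move=> S s [sl su]; split.
    by move=> _ [x Sx <-]; rewrite le_below !val_restr leI2// sl.
  move=> y yl; rewrite le_below val_restr lexI (valP y) andbT.
  apply: su => x Sx; have := yl (restr aI x).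
  rewrite le_below val_restr lexI => h.
  by have /andP[] := h (ex_intro2 _ _ x Sx erefl).
Qed.

(** The lower adjoint of the restriction is the inclusion [val]. *)
Lemma restr_doplc : doplc_morphism rho bd eta J (restr aI).
Proof.
have [[_ Id _] Ibd Ill] := HI.
exists val; split.
- exact: restr_complete_hom.
- by move=> a b; rewrite le_below val_restr lexI (valP b) andbT.
- move=> a b /restr_contact_sub; rewrite !val_restr => r.
  by apply: (contact_mono HA r); apply: leIl.
- by move=> b /Ibd.
- move=> a b Jb r; have [e [Ie nbe]] := Ill _ Jb.
  apply/restr_contactE => //; have [r'|//] := contact_split HA e r.
  apply: (contact_mono HA r') => //.
  by rewrite val_restr leI2// mem_le_supremum.
Qed.

End Restriction.

(** * Ultrafilters inside grills *)

Section Grill.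
Import Order.Theory.
Local Open Scope order_scope.
Context {d : Order.disp_t} {A : ctbDistrLatticeType d}.
Implicit Types (G u : set A) (a b : A).

(** The complement of a grill is an ideal, so this is the Boolean prime ideal
    theorem.  Zorn's lemma is applied to the filters [F] all of whose members
    [x] satisfy [G (x `&` a)]; a maximal one automatically contains [a]. *)
Lemma grill_ultrafilter G a :
  ~ G \bot -> (forall x y, G x -> x <= y -> G y) ->
  (forall x y, G (x `|` y) -> G x \/ G y) -> G a ->
  exists u, [/\ is_ultrafilter u, u a & (u `<=` G)%classic].
Proof.
move=> G0 Gu GU Ga.
pose P (F : set A) := [/\ forall x y, F x -> x <= y -> F y,
  forall x y, F x -> F y -> F (x `&` y) & forall x, F x -> G (x `&` a)].
have [E EP tE|M [[Mu MI MG] mx]] := @Zorn_bigcup A P.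
  split.
  - move=> x y [F EF Fx] xy; exists F => //.
    by have [Fu _ _] := EP _ EF; apply: Fu xy.
  - move=> x y [F EF Fx] [F' EF' Fy].
    have [_ FI _] := EP _ EF; have [_ FI' _] := EP _ EF'.
    by have [FF'|F'F] := tE _ _ EF EF'; [exists F'|exists F] => //;
      [apply: FI' => //; apply: FF'|apply: FI => //; apply: F'F].
  - by move=> x [F EF Fx]; have [_ _] := EP _ EF; apply.
(* Adding [b] to [M] generates [N]; the disjunct [b <= y] makes this correct
   even before [M] is known to be inhabited. *)
have ext b : G (b `&` a) -> (forall m, M m -> G (m `&` b `&` a)) -> M b.
  move=> Gb GMb; apply: contrapT => nMb.
  pose N := [set y | b <= y \/ exists2 m, M m & m `&` b <= y].
  apply: (mx N).
    split; first by move=> m Mm; right; exists m => //; apply: leIl.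
    by move=> NM; apply: nMb; apply: NM; left.
  split.
  - move=> y z [my|[m Mm my]] yz; first by left; apply: le_trans yz.
    by right; exists m => //; apply: le_trans yz.
  - move=> y z [my|[m Mm my]] [nz|[n Mn nz]].
    + by left; rewrite lexI my.
    + right; exists n => //; rewrite lexI nz andbT.
      by apply: le_trans my; apply: leIr.
    + right; exists m => //; rewrite lexI my /=.
      by apply: le_trans nz; apply: leIr.
    + right; exists (m `&` n); first exact: MI.
      rewrite lexI; apply/andP; split.
        by apply: le_trans my; rewrite leI2// leIl.
      by apply: le_trans nz; rewrite leI2// leIr.
  - move=> y [my|[m Mm my]]; first by apply: Gu Gb _; rewrite leI2.
    by apply: Gu (GMb _ Mm) _; rewrite leI2.
have Ma : M a.
  by apply: ext; rewrite ?meetxx// => m /MG; rewrite -meetA meetxx.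
have Mp b : M b \/ M (~` b).
  case: (pselect (M b)) => nMb; [by left|right].
  (* If [n] witnesses that [b] is rejected, only [~` b] is large below [n]. *)
  have [n Mn nb] : exists2 n, M n & ~ G (n `&` b `&` a).
    apply: contrapT => ne; apply: nMb; apply: ext.
      apply: contrapT => nG; apply: ne; exists a => //.
      by rewrite [a `&` b]meetC -meetA meetxx.
    by move=> n Mn; apply: contrapT => nG; apply: ne; exists n.
  have key m : M m -> G (m `&` ~` b `&` a).
    move=> Mm; have := MG _ (MI _ _ Mm Mn).
    have -> : m `&` n `&` a
        = (m `&` n `&` b `&` a) `|` (m `&` n `&` ~` b `&` a).
      by rewrite -meetUl -meetUr joinxC meetx1.
    case/GU => g; last by apply: Gu g _; rewrite !leI2// leIl.
    by case: nb; apply: Gu g _; rewrite !leI2// leIr.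
  apply: ext => //; apply: Gu (key _ Ma) _.
  by rewrite leI2// leIr.
have MsubG : (M `<=` G)%classic by move=> x /MG Gx; apply: Gu Gx _; apply: leIl.
exists M; split=> //; apply: prime_ultrafilter => //.
by split=> //; [exists a|move=> /MsubG].
Qed.

End Grill.

(** * The space of bounded clusters and its regular closed sets *)

Section Representation.
Import Order.Theory.
Local Open Scope order_scope.
Context {d : Order.disp_t} {A : ctbDistrLatticeType d}.
Context {rho : A -> A -> Prop} {bd : set A} (H : is_lca rho bd).
Implicit Types (a b c : A) (s t : Psi_a H).
Local Notation lam a := (@lambda _ _ _ _ H a).

Lemma Psi_a_up s a b : bcluster s a -> a <= b -> bcluster s b.
Proof. exact: (cluster_up H (bclusterP s)). Qed.

Lemma Psi_a_split s a b : bcluster s a ->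
  bcluster s (a `&` b) \/ bcluster s (~` b).
Proof.
move=> sa; have := sa; rewrite -{1}(joinIB b a).
case/(cluster_K2 (bclusterP s)) => h; first by left.
by right; apply: Psi_a_up h _; rewrite diffE leIr.
Qed.

Lemma Psi_a_ll s a e :
  bd a -> bcluster s a -> ll rho a e -> ~ bcluster s (~` e).
Proof.
by move=> ba sa nae se; have [/nae|[]] := cluster_K1 (bclusterP s) sa se.
Qed.

(** A bounded cluster, although it is not a filter, has a bounded element whose
    complement it avoids; this is what makes the point have a compact
    neighbourhood, and lets unbounded members be cut down to bounded ones. *)
Lemma Psi_a_omit s : exists2 e, bd e & ~ bcluster s (~` e).
Proof.
have [a sa ba] := bcluster_bounded s.
have [e [be nae]] := bounded_ll_bounded H ba.
by exists e => //; apply: Psi_a_ll nae.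
Qed.

Lemma Psi_a_top s : bcluster s \top.
Proof. by have [a sa _] := bcluster_bounded s; apply: Psi_a_up sa (lex1 _). Qed.

Lemma Psi_aC s e : ~ bcluster s (~` e) -> bcluster s e.
Proof.
by move=> ne; have [|//] := Psi_a_split e (Psi_a_top s); rewrite meet1x.
Qed.

(** Enough points: (BC3) puts a bounded [c] well inside the nonzero difference
    of [a] and [b], and the cluster of any ultrafilter through [c] separates
    them. *)
Lemma exists_separating_point a b : ~ (a <= b) ->
  exists s, bcluster s a /\ ~ bcluster s b.
Proof.
rewrite -{1}[b]complK -disj_leC => /negP/eqP n0.
have [c [bc c0 nc]] := lca_BC3 H n0.
have [|||u [Uu uc _]] := @grill_ultrafilter _ _ [set x | x <> \bot] c _ _ _ c0.
- by apply.
- by move=> x y x0 xy e; apply: x0; apply/eqP; rewrite -lex0 -e.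
- move=> x y xy0; apply: contrapT => n; apply: xy0; apply/eqP; rewrite join_eq0.
  by apply/andP; split; apply/eqP; apply: contrapT => ?; apply: n; [left|right].
pose s := bu_cluster H Uu (ex_intro2 _ _ c uc bc : meets_bd bd u).
have sc : bcluster s c by apply: (ultrafilter_sub_cluster H Uu).
exists s; split.
  by apply: Psi_a_up sc _; apply: le_trans (ll_le H nc) (leIl _ _).
move=> sb; apply: (Psi_a_ll bc sc nc); apply: Psi_a_up sb _.
by rewrite complI complK leUr.
Qed.

Lemma lambda_le a b : (lam a `<=` lam b)%classic <-> a <= b.
Proof.
split=> [ab|ab s sa]; last exact: Psi_a_up sa ab.
by apply: contrapT => /exists_separating_point[s [/ab]].
Qed.

Lemma lambda_join a b : lam (a `|` b) = (lam a `|` lam b)%classic.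
Proof.
apply/seteqP; split=> [s /(cluster_K2 (bclusterP s))//|s [] sa].
  by apply: Psi_a_up sa (leUl _ _).
by apply: Psi_a_up sa (leUr _ _).
Qed.

Lemma lambda0 : lam \bot = set0.
Proof. by apply/seteqP; split=> // s /(cluster_not0 H (bclusterP s)). Qed.

Lemma lambda1 : lam \top = setT.
Proof. by apply/seteqP; split=> // s _; apply: Psi_a_top. Qed.

Lemma closed_lambda a : closed (lam a).
Proof. by apply/Psi_a_closedP; exists [set a]; rewrite bigcap_set1. Qed.

Lemma lambdaC_sub a : (~` lam (~` a)%O `<=` lam a)%classic.
Proof. by move=> s; apply: Psi_aC. Qed.

Lemma nbhs_lambdaC s (N : set (Psi_a H)) : nbhs s N ->
  exists c, ~ bcluster s c /\ (~` lam c `<=` N)%classic.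
Proof.
rewrite nbhsE => -[O [oO Os] ON].
have [S OE] := (Psi_a_closedP _).1 (open_closedC oO).
have [c Sc nsc] : exists2 c, S c & ~ bcluster s c.
  apply: contrapT => n; suff : (~` O)%classic s by apply.
  by rewrite OE => c Sc; apply: contrapT => ?; apply: n; exists c.
exists c; split=> // t ntc; apply: ON; apply: contrapT => nOt.
by have : (~` O)%classic t by []; rewrite OE => /(_ _ Sc).
Qed.

Lemma lambdaC_nbhs s c : ~ bcluster s c -> nbhs s (~` lam c)%classic.
Proof.
move=> nsc; apply: open_nbhs_nbhs; split=> //.
exact/closed_openC/closed_lambda.
Qed.

(** If a basic neighbourhood, the complement of [lam c], missed the complement
    of [lam a], then [lam (a `|` c)] would be the whole space and [c] would lie
    above [~` a]. *)
Lemma closure_lambdaC a : closure (~` lam a)%classic = lam (~` a).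
Proof.
apply/seteqP; split.
  rewrite [X in (_ `<=` X)%classic](closure_id _).1; last exact: closed_lambda.
  by apply: closureS => s; rewrite -{1}[a]complK; apply: lambdaC_sub.
move=> s sa N /nbhs_lambdaC[c [nsc cN]].
have [|t [_ nt]] := @exists_separating_point \top (a `|` c).
  rewrite le1x => /eqP e; apply: nsc; apply: Psi_a_up sa _.
  by rewrite -[c]complK -disj_leC -complU e compl1.
exists t; split; first by move=> ta; apply: nt; apply: Psi_a_up ta (leUl _ _).
by apply: cN => tc; apply: nt; apply: Psi_a_up tc (leUr _ _).
Qed.

Lemma regclosed_lambda a : regclosed (lam a).
Proof.
by rewrite /regclosed -{1}[lam a]setCK interiorC !closure_lambdaC complK.
Qed.

(** For the direct implication, the elements in contact with [b] form a grill;
    an ultrafilter inside it through [a] has [b] in its cluster by the very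
    definition of [cluster_of].  (BC2) first makes [a] bounded.  Conversely, a
    point rules out that two of its members are related merely by being
    unbounded, since one of them can be cut down by [Psi_a_omit]. *)
Lemma lambda_contact a b : rho a b <-> (lam a `&` lam b !=set0)%classic.
Proof.
split.
  move=> /(lca_C3 H)/(lca_BC2 H)[c [bc r]].
  have [_ Hd _] := lca_ideal H.
  have [|||u [Uu uca ur]] :=
    @grill_ultrafilter _ _ [set x | rho b x] (c `&` a) _ _ _ r.
  - by move=> /(lca_C2 H)[].
  - by move=> x y /= bx xy; apply: (contact_mono H bx).
  - by move=> x y /= /(lca_C4 H).
  have bca : bd (c `&` a) by apply: Hd bc (leIl _ _).
  exists (bu_cluster H Uu (ex_intro2 _ _ _ uca bca : meets_bd bd u)); split.
    by apply: Psi_a_up (leIr a c); apply: (ultrafilter_sub_cluster H Uu).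
  by move=> x /ur; left.
move=> [s [sa sb]]; have [e be ne] := Psi_a_omit s.
have [_ Hd _] := lca_ideal H.
have [sae|/ne//] := Psi_a_split e sa.
have bae : bd (a `&` e) by apply: Hd be (leIr _ _).
have [r|[]//] := cluster_K1 (bclusterP s) sae sb.
by apply: (contact_mono H r) => //; apply: leIl.
Qed.

(** The elements [c] whose [lam c] belongs to an ultrafilter [F] of sets form a
    grill.  Its members are pairwise in contact, so it is contained in the
    cluster of any ultrafilter inside it.  An ultrafilter through the bounded
    element [a] gives a point, and [F] converges to it. *)
Lemma compact_lambda a : bd a -> compact (lam a).
Proof.
move=> ba; rewrite compact_ultra => F UF Fa; pose G := [set c | F (lam c)].
have [|||u [Uu ua uG]] := @grill_ultrafilter _ _ G a _ _ _ Fa.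
- by rewrite /G /= lambda0; apply: filter_not_empty.
- by move=> x y Fx /lambda_le xy; apply: filterS xy Fx.
- move=> x y; rewrite /G /= lambda_join => Fxy.
  have [|Fx] := in_ultra_setVsetC (lam x) UF; [by left|right].
  by apply: filterS (filterI Fxy Fx) => s [[]].
pose s := bu_cluster H Uu (ex_intro2 _ _ _ ua ba : meets_bd bd u).
have Gs c : G c -> bcluster s c.
  move=> Gc x /uG Gx; left; apply/lambda_contact.
  exact: (filter_ex (filterI Gc Gx)).
exists s; split; first exact: Gs.
move=> N /nbhs_lambdaC[c [nsc cN]]; apply: filterS cN _.
by have [/Gs|//] := in_ultra_setVsetC (lam c) UF.
Qed.

(** If [a] is unbounded, the sets [lam a] minus [lam e], for [e] bounded, are
    nonempty and generate a filter.  It has no cluster point: every point has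
    a neighbourhood inside some [lam e] with [e] bounded. *)
Lemma lambda_compact a : compact (lam a) -> bd a.
Proof.
have [bd0 Hd HU] := lca_ideal H.
move=> ca; apply: contrapT => nba.
pose D (e : A) := (lam a `\` lam e)%classic.
pose F := filter_from bd D.
have PF : ProperFilter F.
  apply: filter_from_proper.
    apply: filter_from_filter; first by exists \bot.
    move=> x y bx yb; exists (x `|` y); first exact: HU.
    move=> s [sa]; rewrite lambda_join => nxy.
    by split; split=> // h; apply: nxy; [left|right].
  move=> e be; have [|s [sa se]] := @exists_separating_point a e.
    by move=> /(Hd _ _ be).
  by exists s.
have Fa : F (lam a) by exists \bot => // s [].
have [s [sa cs]] := ca F PF Fa; have [e be ne] := Psi_a_omit s.
have FD : F (D e) by exists e.
by have [t [[_ nte] /lambdaC_sub]] := cs _ _ FD (lambdaC_nbhs ne).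
Qed.

(** Two distinct clusters contain elements that are not in contact, the first of
    them bounded; an interpolant [e] between one and the complement of the other
    yields the disjoint neighbourhoods: the complements of [lam (~` e)] and of
    [lam e]. *)
Lemma hausdorff_Psi_a : hausdorff_space (Psi_a H).
Proof.
move=> s t cst; apply: contrapT => nst.
have [_ Hd _] := lca_ideal H.
have [a sa nta] : exists2 a, bcluster s a & ~ bcluster t a.
  apply: contrapT => n; apply: nst; apply: Psi_aP.
  apply: (cluster_eq (bclusterP s) (bclusterP t)) => a sa.
  by apply: contrapT => ?; apply: n; exists a.
have [g bg ng] := Psi_a_omit s.
have [sag|/ng//] := Psi_a_split g sa.
have bag : bd (a `&` g) by apply: Hd bg (leIr _ _).
have [b tb nab] : exists2 b, bcluster t b & ~ Crel rho bd (a `&` g) b.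
  apply: contrapT => n; apply: nta.
  apply: (@Psi_a_up _ (a `&` g)); last exact: leIl.
  apply: (cluster_K3 (bclusterP t)) => b tb.
  by apply: contrapT => ?; apply: n; exists b.
have [|e [be ae eb]] := lca_BC1 H bag (c := ~` b).
  by rewrite /ll complK => r; apply: nab; left.
have nte : ~ bcluster t e.
  by move=> te; apply: (Psi_a_ll be te eb); rewrite complK.
have nse := Psi_a_ll bag sag ae.
have [v [nv1 nv2]] := cst _ _ (lambdaC_nbhs nse) (lambdaC_nbhs nte).
by apply: nv2; apply: lambdaC_sub.
Qed.

Lemma locally_compact_Psi_a : locally_compact [set: Psi_a H].
Proof.
move=> s _; have [e be ne] := Psi_a_omit s.
exists (lam e); last by split; [exact: compact_lambda|exact: closed_lambda].
rewrite withinET; apply: filterS (lambdaC_nbhs ne); exact: lambdaC_sub.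
Qed.

Definition lambda_RC a : RC (Psi_a H) := MkRC (regclosed_lambda a).

(** A regular closed [F] is represented by the join of all [x] with [lam x]
    inside [F].  As [F] is an intersection of sets [lam e], the join stays
    inside [F]; as the interior of [F] is a union of complements of sets
    [lam c], whose closures are the [lam (~` c)], the join reaches all of [F]. *)
Lemma lambda_RC_surj (F : RC (Psi_a H)) : complete_lattice A ->
  exists a, lambda_RC a = F.
Proof.
move=> cA; pose S := [set x | lam x `<=` F]%classic.
have [a [au al]] := cA S; exists a; apply: RC_inj; apply/seteqP; split=> /=.
  have [T FE] := (Psi_a_closedP _).1 (@RC_closed _ F); rewrite FE => s sa e Te.
  apply: (Psi_a_up sa); apply: al => x xF; apply/lambda_le.
  by apply: subset_trans xF _; rewrite FE => t; apply.
rewrite -[X in (X `<=` _)%classic](rcsetP F).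
rewrite [X in (_ `<=` X)%classic](closure_id _).1; last exact: closed_lambda.
apply: closureS => s /nbhs_interior/nbhs_lambdaC[c [nsc cF]].
have sc' : bcluster s (~` c) by apply: Psi_aC; rewrite complK.
apply: Psi_a_up sc' _; apply: au; rewrite /S /= -closure_lambdaC.
rewrite -(rcsetP F); exact: closureS.
Qed.

(** Roeper's representation theorem: a complete local contact algebra is
    isomorphic to that of the regular closed subsets of its dual space. *)
Theorem lca_representation : complete_lattice A ->
  lca_isomorphic rho bd (@rc_contact (Psi_a H)) (@CR (Psi_a H)).
Proof.
move=> cA; exists lambda_RC.
have inj : injective lambda_RC.
  move=> a b /(congr1 (@rcset _)) /= ab; apply: le_anti; apply/andP.
  by split; apply/lambda_le; rewrite ab.
have hC : {morph lambda_RC : a / ~` a}.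
  by move=> a; apply: RC_inj; rewrite RC_complE /= closure_lambdaC.
have hU : {morph lambda_RC : a b / a `|` b}.
  by move=> a b; apply: RC_inj; rewrite RC_joinE /= lambda_join.
split.
- have [g gE] : exists g, forall F, lambda_RC (g F) = F.
    exists (fun F => projT1 (cid (lambda_RC_surj F cA))) => F.
    exact: (projT2 (cid (lambda_RC_surj F cA))).
  by exists g => // a; apply: inj; rewrite gE.
- split=> //.
  + by apply: RC_inj; rewrite RC_botE /= lambda0.
  + by apply: RC_inj; rewrite RC_topE /= lambda1.
  + by move=> a b; rewrite -[a `&` b]complK complI hC hU !hC complU !complK.
- exact: lambda_contact.
- apply/seteqP; split=> [_ [a ba <-]|F cF]; first exact: compact_lambda.
  have [a aF] := lambda_RC_surj F cA; exists a => //.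
  by apply: lambda_compact; have : compact (rcset F) by []; rewrite -aF.
Qed.

End Representation.

(** * Invariance under homeomorphism *)

Section Homeomorphism.
Import Order.Theory.
Context {S T : topologicalType}.

Lemma hausdorff_homeomorphic :
  homeomorphic S T -> hausdorff_space S -> hausdorff_space T.
Proof.
move=> [f [g [fK gK cf cg]]] hS p q cpq; apply: (can_inj gK); apply: hS.
by move=> N M /cg Np /cg Mq; have [t [Nt Mt]] := cpq _ _ Np Mq; exists (g t).
Qed.

Lemma preimage_homeomorphism (f : S -> T) (g : T -> S) (F : set S) :
  cancel f g -> cancel g f -> g @^-1` F = f @` F.
Proof.
move=> fK gK; apply/seteqP; split=> [t Ft|_ [x Fx <-]].
  by exists (g t); rewrite ?gK.
by rewrite /preimage /= fK.
Qed.

Lemma compact_homeomorphism (f : S -> T) (g : T -> S) (F : set S) :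
  cancel f g -> cancel g f -> continuous f -> compact F -> compact (g @^-1` F).
Proof.
move=> fK gK cf cF; rewrite (preimage_homeomorphism F fK gK).
by apply: continuous_compact => //; apply: continuous_subspaceT.
Qed.

Lemma locally_compact_homeomorphic :
  homeomorphic S T -> locally_compact [set: S] -> locally_compact [set: T].
Proof.
move=> [f [g [fK gK cf cg]]] lS t _; have [K + [cK clK]] := lS (g t) Logic.I.
rewrite withinET => nK; exists (g @^-1` K).
  by rewrite withinET; apply: cg.
split; first exact: compact_homeomorphism cK.
exact: (continuous_closedP g).1 cg _ clK.
Qed.

Lemma closure_homeomorphism (f : S -> T) (g : T -> S) (F : set S) :
  cancel f g -> cancel g f -> continuous f -> continuous g ->
  closure (g @^-1` F) = g @^-1` closure F.
Proof.
move=> fK gK cf cg; apply/seteqP; split=> t ct N.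
  by move=> /cg Nt; have [x [Fx Nx]] := ct _ Nt; exists (g x).
move=> Nt; have Nt' : nbhs (f (g t)) N by rewrite gK.
by have [x [Fx Nx]] := ct _ (cf _ _ Nt'); exists (f x); rewrite /preimage /= fK.
Qed.

Lemma interior_homeomorphism (f : S -> T) (g : T -> S) (F : set S) :
  cancel f g -> cancel g f -> continuous f -> continuous g ->
  interior (g @^-1` F) = g @^-1` interior F.
Proof.
move=> fK gK cf cg; rewrite -[F]setCK -preimage_setC !interiorC.
by rewrite (closure_homeomorphism _ fK gK cf cg) preimage_setC.
Qed.

Lemma regclosed_homeomorphism (f : S -> T) (g : T -> S) (F : RC S) :
  cancel f g -> cancel g f -> continuous f -> continuous g ->
  regclosed (g @^-1` rcset F).
Proof.
move=> fK gK cf cg; rewrite /regclosed (interior_homeomorphism _ fK gK cf cg).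
by rewrite (closure_homeomorphism _ fK gK cf cg) rcsetP.
Qed.

Lemma homeomorphic_open_embedding (f : S -> T) (O : set T) :
  continuous f -> injective f -> (forall V, open V -> open (f @` V)) ->
  range f = O -> homeomorphic S (set_type O).
Proof.
move=> cf injf of_ <-{O}.
have fO s : f s \in range f by rewrite inE; exists s.
pose h s : set_type (range f) := SigSub (fO s).
have ex (z : set_type (range f)) : exists s, f s = val z.
  by have /set_mem[s _ <-] := valP z; exists s.
pose g z := projT1 (cid (ex z)).
have gE z : f (g z) = val z by exact: (projT2 (cid (ex z))).
exists h, g; split.
- by move=> s; apply: injf; rewrite gE.
- by move=> z; apply: val_inj; rewrite /= gE.
- apply/continuousP => _ [W oW <-]; exact: ((continuousP f).1 cf).
- apply/continuousP => V oV; exists (f @` V); first exact: of_.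
  apply/seteqP; split=> z; rewrite /preimage /=.
    by move=> [s Vs fs]; have <- : s = g z by apply: injf; rewrite gE.
  by move=> Vz; exists (g z) => //; rewrite gE.
Qed.

End Homeomorphism.

Lemma dual_lca_homeomorphic (S T : topologicalType) : homeomorphic S T ->
  lca_isomorphic (@rc_contact S) (@CR S) (@rc_contact T) (@CR T).
Proof.
move=> [f [g [fK gK cf cg]]].
pose h (F : RC S) := MkRC (regclosed_homeomorphism F fK gK cf cg).
pose k (F : RC T) := MkRC (regclosed_homeomorphism F gK fK cg cf).
have kK : cancel k h.
  move=> F; apply: RC_inj; apply/seteqP.
  by split=> t; rewrite /= /preimage /= gK.
exists h; split.
- exists k => // F.
  by apply: RC_inj; apply/seteqP; split=> t; rewrite /= /preimage /= fK.
- split=> //.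
  + by apply: RC_inj.
  + by apply: RC_inj.
  + move=> F G; apply: RC_inj; rewrite !RC_meetE /=.
    rewrite -preimage_setI (interior_homeomorphism _ fK gK cf cg).
    by rewrite (closure_homeomorphism _ fK gK cf cg).
  + by move=> F G; apply: RC_inj.
  + move=> F; apply: RC_inj; rewrite !RC_complE /=.
    by rewrite preimage_setC (closure_homeomorphism _ fK gK cf cg).
- move=> F G; split=> [[s [Fs Gs]]|[t [Ft Gt]]]; last by exists (g t).
  by exists (f s); split; rewrite /= /preimage /= fK.
- apply/seteqP; split=> [_ [F cF <-]|F cF].
    exact: compact_homeomorphism fK gK cf cF.
  exists (k F); last exact: kK.
  exact: compact_homeomorphism gK fK cg cF.
Qed.

Lemma lca_isomorphic_trans d1 d2 d3 (A : ctbDistrLatticeType d1)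
    (B : ctbDistrLatticeType d2) (C : ctbDistrLatticeType d3)
    (r1 : A -> A -> Prop) (b1 : set A) (r2 : B -> B -> Prop) (b2 : set B)
    (r3 : C -> C -> Prop) (b3 : set C) :
  lca_isomorphic r1 b1 r2 b2 -> lca_isomorphic r2 b2 r3 b3 ->
  lca_isomorphic r1 b1 r3 b3.
Proof.
move=> [h [hb [h0 h1 hI hU hC] hr <-]] [k [kb [k0 k1 kI kU kC] kr <-]].
exists (k \o h); split.
- exact: bij_comp.
- split=> /=; first by rewrite h0.
  + by rewrite h1.
  + by move=> a b /=; rewrite hI kI.
  + by move=> a b /=; rewrite hU kU.
  + by move=> a /=; rewrite hC kC.
- by move=> a b; rewrite hr kr.
- by rewrite image_comp.
Qed.

(** * The dual map of a morphism *)

Section DualMap.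
Import Order.Theory.
Local Open Scope order_scope.
Context {d : Order.disp_t} {A : ctbDistrLatticeType d}.
Context {d' : Order.disp_t} {B : ctbDistrLatticeType d'}.
Context {rho : A -> A -> Prop} {bd : set A}.
Context {eta : B -> B -> Prop} {bd' : set B} {phi : A -> B}.
Context (HA : is_lca rho bd) (HB : is_lca eta bd').
Context (Hphi : doplc_morphism rho bd eta bd' phi).
Local Notation f := (Psi_a_map HA HB Hphi).

(** On clusters, rather than on the ultrafilters that determine them, the dual
    map is the inverse image under [phi].  One inclusion is (L1); the other
    uses (LO) at [phiL b], for bounded [b] in the ultrafilter. *)
Lemma Psi_a_map_preim s a : bcluster (f s) a <-> bcluster s (phi a).
Proof.
have [phiL [_ adj L1 L2 LO]] := Hphi.
have [u [Uu Bu su]] := Psi_a_surj s; have [Fu _] := Uu; have [_ _ uu uI] := Fu.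
have -> : s = bu_cluster HB Uu Bu by apply: Psi_aP.
rewrite Psi_a_mapE /=; split=> h b ub.
  have [b0 ub0 bb0] := Bu; have [_ Hd _] := lca_ideal HB.
  have bI : bd' (b `&` b0) by apply: Hd bb0 (leIr _ _).
  have uphi : u (phi (phiL (b `&` b0))).
    by apply: uu (uI _ _ ub ub0) _; rewrite -adj.
  have /(lca_C3 HA)/(LO _ _ bI) r := Crel_bounded_filter HA
    (preim_ultrafilter Hphi Uu).1 (preim_bounded Hphi Uu Bu) h uphi.
  left; apply: (lca_C3 HB); apply: (contact_mono HB r) => //; exact: leIl.
by left; apply: L1; apply: (Crel_bounded_filter HB Fu Bu h).
Qed.

Lemma Psi_a_map_continuous : continuous f.
Proof.
apply/continuous_closedP => F /Psi_a_closedP[S ->]; apply/Psi_a_closedP.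
exists (phi @` S)%classic; apply/seteqP; split=> s h.
  by move=> _ [a Sa <-]; apply/Psi_a_map_preim/h.
by move=> a Sa; apply/Psi_a_map_preim/h; exists a.
Qed.

(** A section of [phi] makes the dual map a topological embedding, because
    every basic closed set is then an inverse image: [lambda b] is that of
    [lambda (psi b)]. *)
Context {psi : B -> A} (phiK : cancel psi phi).

Lemma Psi_a_map_inj : injective f.
Proof.
move=> s t st; apply: Psi_aP; apply/seteqP.
by split=> b; rewrite -[b]phiK => /Psi_a_map_preim; [rewrite st|rewrite -st];
  move/Psi_a_map_preim.
Qed.

Lemma Psi_a_map_open (V : set (Psi_a HB)) :
  open (range f) -> open V -> open (f @` V)%classic.
Proof.
move=> oR /open_closedC/Psi_a_closedP[S VE].
pose W := (\bigcap_(b in S) lambda (psi b))%classic : set (Psi_a HA).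
have -> : (f @` V)%classic = (range f `&` ~` W)%classic.
  have fW s : W (f s) <-> (~` V)%classic s.
    rewrite VE; split=> h b Sb; last first.
      by apply/Psi_a_map_preim; rewrite phiK; apply: h.
    by rewrite -[b]phiK; apply/Psi_a_map_preim/h.
  apply/seteqP; split=> [_ [s Vs <-]|_ [[s _ <-] nW]].
    by split; [exists s|move=> /fW].
  by exists s => //; apply: contrapT => nV; apply: nW; apply/fW.
apply: openI => //; apply: closed_openC; apply/Psi_a_closedP.
by exists (psi @` S)%classic; rewrite bigcap_image.
Qed.

End DualMap.

(** * The open set of a delta-ideal *)

Section DeltaIdealOpen.
Import Order.Theory.
Local Open Scope order_scope.
Context {d : Order.disp_t} {A : ctbDistrLatticeType d}.
Context {rho : A -> A -> Prop} {bd : set A} (H : is_lca rho bd).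
Context {I : set A} (HI : delta_ideal rho bd I).

(** The delta condition turns the union of the closed sets [lambda a] into a
    union of basic open sets: if [a] is well inside [e], a cluster containing
    [a] omits [~` e]. *)
Lemma iota_lcaP s : iota_lca H I s <-> exists2 e, I e & ~ bcluster s (~` e).
Proof.
have [_ Ibd Ill] := HI; split=> [[a Ia sa]|[e Ie ne]].
  have [e [Ie ae]] := Ill _ Ia; exists e => //.
  by apply: Psi_a_ll ae => //; apply: Ibd.
by exists e => //; apply: Psi_aC.
Qed.

Lemma open_iota : open (iota_lca H I).
Proof.
rewrite openE => s /iota_lcaP[e Ie ne].
rewrite /interior; apply: filterS (lambdaC_nbhs ne) => t nt.
by apply/iota_lcaP; exists e.
Qed.

End DeltaIdealOpen.

Section RestrictionMap.
Import Order.Theory.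
Local Open Scope order_scope.
Context {d : Order.disp_t} {A : ctbDistrLatticeType d}.
Context {rho : A -> A -> Prop} {bd : set A} (HA : is_clca rho bd).
Context {I : set A} (HI : delta_ideal rho bd I).
Let aI : A := supremum \bot I.
Let B := below aI.
Let eta : B -> B -> Prop := restr_contact rho I.
Let J : set B := restr_ideal I.
Context (HB : is_lca eta J) (Hphi : doplc_morphism rho bd eta J (restr aI)).

(** A point of the open set is the cluster of an ultrafilter [v] containing some
    element of [I], hence also the join of [I]; such [v] is the inverse image of
    its trace on the elements below that join. *)
Lemma range_restr_map : range (Psi_a_map HA HB Hphi) = iota_lca HA I.
Proof.
apply/seteqP; split.
  move=> _ [s _ <-]; have [b sb Jb] := bcluster_bounded s.
  by exists (val b) => //; apply/Psi_a_map_preim; rewrite restrK.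
move=> s /(iota_lcaP HI)[e Ie ne].
have [v [Uv Bv vs]] :=
  cluster_is_cluster_of HA (bclusterP s) (bcluster_bounded s).
have [[_ v0 vu vI] _] := Uv.
have ve : v e.
  have [//|vne] := ultrafilter_prime Uv e; case: ne.
  by rewrite -vs; apply: (ultrafilter_sub_cluster HA Uv).
have vaI : v aI by apply: vu ve (mem_le_supremum HA Ie).
pose u : set B := [set b | v (val b)].
have Uu : is_ultrafilter u.
  apply: prime_ultrafilter; last first.
    move=> b; have [vb|vb] := ultrafilter_prime Uv (val b); [by left|right].
    exact: vI vb vaI.
  split.
  - by exists \top.
  - exact: v0.
  - by move=> a b va; rewrite le_below; apply: vu.
  - by move=> a b; apply: vI.
have Bu : meets_bd J u.
  by exists (exist _ e (mem_le_supremum HA Ie)).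
exists (bu_cluster HB Uu Bu) => //; rewrite Psi_a_mapE; apply: Psi_aP => /=.
rewrite -vs; congr cluster_of; apply/seteqP; split=> a /=.
  by move=> /vu; apply; apply: leIl.
by move=> va; apply: vI.
Qed.

End RestrictionMap.

Theorem theorem4p8 (d : Order.disp_t) (A : ctbDistrLatticeType d)
    (rho : A -> A -> Prop) (bd : set A) (HA : is_clca rho bd)
    (I : set A) (HI : delta_ideal rho bd I) :
  let aI : A := supremum \bot%O I in
  let B := below aI in
  let eta : B -> B -> Prop := restr_contact rho I in
  let J : set B := restr_ideal I in
  let phi : A -> B := restr aI in
  exists (HB : is_clca eta J) (Hphi : doplc_morphism rho bd eta J phi),
    let X : topologicalType := Psi_a HA in
    let U : topologicalType := Psi_a HB in
    let f : U -> X := Psi_a_map HA HB Hphi in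
    let O : set X := iota_lca HA I in
    let Z : topologicalType := set_type O in
    [/\ continuous f, injective f,
        forall V : set U, open V -> open (f @` V) & range f = O] /\
    open O /\
    homeomorphic U Z /\
    (hausdorff_space Z /\ locally_compact [set: Z]) /\
    lca_isomorphic eta J (@rc_contact Z) (@CR Z).
Proof.
move=> aI B eta J phi.
pose HB : is_clca eta J := restr_clca HA HI.
pose Hphi : doplc_morphism rho bd eta J phi := restr_doplc HA HI.
exists HB, Hphi => X U f O Z.
have cf : continuous f by apply: Psi_a_map_continuous.
have injf : injective f by apply: Psi_a_map_inj (@restrK _ _ I).
have oO : open O by apply: open_iota.
have rf : range f = O by apply: range_restr_map.
have of_ (V : set U) : open V -> open (f @` V).
  by apply: (Psi_a_map_open (@restrK _ _ I)); rewrite rf.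
have UZ : homeomorphic U Z by apply: homeomorphic_open_embedding rf.
split; first by split.
do 2!split=> //.
split; last first.
  apply: lca_isomorphic_trans (dual_lca_homeomorphic UZ).
  exact: lca_representation (clca_complete HB).
split; first by apply: (hausdorff_homeomorphic UZ); apply: hausdorff_Psi_a.
by apply: (locally_compact_homeomorphic UZ); apply: locally_compact_Psi_a.
Qed.
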